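(* Let $d\geq2$, $\rho\in(0,1)$, and let $0<a_\rho<b_\rho<1$ and $\varepsilon_\rho>0$ be constants having property (P') described in the context. Let $A\subseteq\mathbb R^d$ be any Borel set such that, for some exponent $s>d-\varepsilon_\rho$ and some sequence $R_n\nearrow\infty$ with $$\frac{R_{n+1}}{R_n}\leq\frac{b_\rho}{a_\rho},$$ one has $$\lim_{n\to\infty}\ \sup_{x\in\mathbb R^d}\mathcal H^s_\infty\big(A_{R_n}(x)\big)>1-\rho .$$ Then $A$ admits all sufficiently large distances; i.e., there exists $M>0$ with $\Delta(A)\supseteq[M,\infty)$.
   Context: $\Delta(E,F)=\{|x-y|:x\in E,\ y\in F\}$ and $\Delta(A)=\Delta(A,A)$ ($|\cdot|$ Euclidean norm). The $s$-dimensional dyadic Hausdorff content is $\mathcal H^s_\infty(E)=\inf\{\sum_i\ell(Q_i)^s:E\subseteq\bigcup_{i=1}^\infty Q_i,\ Q_i\text{ closed dyadic cubes}\}$, $s\in(0,d]$, where $\ell(Q)$ is the side-length of $Q$. Normalized truncations: for $x\in\mathbb R^d$, $R\geq1$, $Q(x;R)=x+[0,R]^d$ and $A_R(x)=\{(y-x)/R:y\in A\cap Q(x;R)\}\subseteq[0,1]^d$. Property (P') (for given $d,\rho$): for all Borel sets $E,F\subseteq[0,1]^d$ and all $s\ge d-\varepsilon_\rho$ with $\min\{\mathcal H^s_\infty(E),\mathcal H^s_\infty(F)\}\ge1-\rho$, one has $\Delta(E,F)\supseteq[a_\rho,b_\rho]$. (Such constants, depending only on $d$ and $\rho$, exist for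 all sufficiently small $\rho$.) *)

(* Defs.v *)
From mathcomp Require Import all_boot all_order all_algebra.
From mathcomp Require Import all_classical all_reals all_analysis.

Set Implicit Arguments.
Unset Strict Implicit.
Unset Printing Implicit Defensive.

Import Order.TTheory GRing.Theory Num.Theory.
Import numFieldNormedType.Exports.

Local Open Scope classical_set_scope.
Local Open Scope ring_scope.

(* The library norm on 'rV[R]_d is the sup norm, so the Euclidean norm is
   defined here; the topology on 'rV[R]_d is the usual one in any case. *)
Definition enorm (R : realType) (d : nat) (x : 'rV[R]_d) : R :=
  Num.sqrt (\sum_(i < d) (x 0 i) ^+ 2).

Definition borel (R : realType) (d : nat) (E : set 'rV[R]_d) : Prop :=
  <<s [set U : set 'rV[R]_d | open U] >> E.

Definition dist_set (R : realType) (d : nat) (E F : set 'rV[R]_d) : set R :=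
  [set t : R | exists x y : 'rV[R]_d, [/\ E x, F y & t = enorm (x - y)]].

(* A closed dyadic cube is encoded by its generation j (an arbitrary integer)
   and the integer vector k locating its lower corner 2^-j k. *)
Definition dyadic_side (R : realType) (d : nat) (q : int * 'rV[int]_d) : R :=
  2 ^ (- q.1).

Definition dyadic_cube (R : realType) (d : nat) (q : int * 'rV[int]_d) :
    set 'rV[R]_d :=
  [set x : 'rV[R]_d | forall i : 'I_d,
     (q.2 0 i)%:~R * dyadic_side R q <= x 0 i
       <= (q.2 0 i + 1)%:~R * dyadic_side R q].

(* Only meant for 0 < s <= d. *)
Definition hcontent (R : realType) (d : nat) (s : R) (E : set 'rV[R]_d) :
    \bar R :=
  ereal_inf [set (\sum_(0 <= i <oo) (dyadic_side R (Q i) `^ s)%:E)%E |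
    Q in [set Q : nat -> int * 'rV[int]_d |
            E `<=` \bigcup_i dyadic_cube (Q i)]].

Definition unit_cube (R : realType) (d : nat) : set 'rV[R]_d :=
  [set x : 'rV[R]_d | forall i : 'I_d, 0 <= x 0 i <= 1].

Definition corner_cube (R : realType) (d : nat) (x : 'rV[R]_d) (r : R) :
    set 'rV[R]_d :=
  [set y : 'rV[R]_d | forall i : 'I_d, x 0 i <= y 0 i <= x 0 i + r].

Definition truncation (R : realType) (d : nat) (A : set 'rV[R]_d)
    (r : R) (x : 'rV[R]_d) : set 'rV[R]_d :=
  [set r^-1 *: (y - x) | y in A `&` corner_cube x r].

Definition propP' (R : realType) (d : nat) (rho a b eps : R) : Prop :=
  forall (E F : set 'rV[R]_d) (s : R),
    borel E -> borel F ->
    E `<=` @unit_cube R d -> F `<=` @unit_cube R d ->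
    0 < s <= d%:R -> d%:R - eps <= s ->
    ((1 - rho)%:E <= Order.min (hcontent s E) (hcontent s F))%E ->
    `[a, b] `<=` dist_set E F.

(* Main.v *)
Require Import Defs.
From mathcomp Require Import all_boot all_order all_algebra.
From mathcomp Require Import all_classical all_reals all_analysis.
Import Order.TTheory GRing.Theory Num.Theory.
Import numFieldNormedType.Exports.
Local Open Scope classical_set_scope.
Local Open Scope ring_scope.

(** The truncation of A to a cube of side R is a copy of a part of A, rescaled
    by 1/R into the unit cube: a distance t between two of its points is a
    distance R * t between two points of A ([dist_set_truncation]). Since the
    limit of the suprema exceeds 1 - rho, for every large n some truncation of
    A at scale r n has content at least 1 - rho. It is Borel
    ([borel_truncation]), so property (P'), applied with both sets equal to it,
    shows that the distance set of A contains [a * r n, b * r n].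

    The bound r (n + 1) / r n <= b / a says exactly that
    a * r (n + 1) <= b * r n, so consecutive intervals overlap or touch; as
    r n tends to infinity they leave no gap above a * r N
    ([exists_scale_interval]), and M = a * r N works for N large. *)

Lemma borel_preimage {R : realType} {d : nat} (f : 'rV[R]_d -> 'rV[R]_d)
    (E : set 'rV[R]_d) :
  continuous f -> borel E -> borel (f @^-1` E).
Proof.
move=> cf bE; rewrite /borel -[f @^-1` E]setTI.
(* The sets with a Borel preimage form a sigma-algebra, so it is enough that it
   contains the open sets. *)
apply: (@smallest_sub _ (sigma_algebra setT)
  _ (image_set_system setT f (@borel R d)) _ _ E bE).
  exact/sigma_algebra_image/smallest_sigma_algebra.
move=> U oU; apply: sub_sigma_algebra; rewrite setTI.
by apply: open_comp oU => x _; exact: cf.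
Qed.

Lemma borelI {R : realType} {d : nat} (E F : set 'rV[R]_d) :
  borel E -> borel F -> borel (E `&` F).
Proof.
exact: (@measurableI _
  (g_sigma_algebraType [set U : set 'rV[R]_d | open U]) E F).
Qed.

Lemma closed_unit_cube {R : realType} {d : nat} : closed (@unit_cube R d).
Proof.
have -> : @unit_cube R d =
    \bigcap_(i : 'I_d) ((fun x : 'rV[R]_d => x 0 i) @^-1` `[0, 1]).
  apply/seteqP; split=> [x xI i _|x xI i]; first by rewrite /= in_itv; exact: xI.
  by have := xI i I; rewrite /= in_itv.
apply: closed_bigI => i _; apply: closed_comp => [x _|].
  exact: coord_continuous.
exact: interval_closed.
Qed.

Lemma borel_unit_cube {R : realType} {d : nat} : borel (@unit_cube R d).
Proof.
rewrite -[@unit_cube R d]setCK -setTD; apply: sigma_algebraCD.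
apply: sub_sigma_algebra; apply: closed_openC; exact: closed_unit_cube.
Qed.

Lemma truncation_subset_unit_cube {R : realType} {d : nat} (A : set 'rV[R]_d)
    (r : R) (x : 'rV[R]_d) :
  0 < r -> truncation A r x `<=` @unit_cube R d.
Proof.
move=> r0 _ [y [_ yQ] <-] i; have /andP[xy yx] := yQ i; rewrite !mxE.
rewrite mulr_ge0 ?invr_ge0 ?subr_ge0 ?(ltW r0)//=.
by rewrite ler_pdivrMl// mulr1 lerBlDl.
Qed.

(** Written as a preimage under the inverse affine map, a truncation is visibly
    built from Borel sets by operations that preserve them. *)
Lemma truncationE {R : realType} {d : nat} (A : set 'rV[R]_d)
    (r : R) (x : 'rV[R]_d) : 0 < r ->
  truncation A r x = (fun z => r *: z + x) @^-1` A `&` @unit_cube R d.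
Proof.
move=> r0; have rN0 : r != 0 by rewrite gt_eqF.
apply/seteqP; split=> z.
  move=> zA; split; last exact: truncation_subset_unit_cube zA.
  by case: zA => y [Ay _] <- /=; rewrite scalerA mulfV// scale1r subrK.
move=> [Az zI]; exists (r *: z + x); last first.
  by rewrite addrK scalerA mulVf// scale1r.
split=> // i; have /andP[z0 z1] := zI i; rewrite !mxE.
by rewrite lerDr mulr_ge0 ?(ltW r0)//= addrC lerD2l ger_pMr.
Qed.

Lemma borel_truncation {R : realType} {d : nat} (A : set 'rV[R]_d)
    (r : R) (x : 'rV[R]_d) : 0 < r -> borel A -> borel (truncation A r x).
Proof.
move=> r0 bA; rewrite truncationE//; apply: borelI; last exact: borel_unit_cube.
apply: borel_preimage bA => z.
apply: (@cvgD _ 'rV[R]_d _ (nbhs z) _ (fun z => r *: z) (fun=> x)).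
  exact: scaler_continuous.
exact: cvg_cst.
Qed.

Lemma enormZ {R : realType} {d : nat} (c : R) (x : 'rV[R]_d) :
  enorm (c *: x) = `|c| * enorm x.
Proof.
rewrite /enorm -sqrtr_sqr -sqrtrM ?sqr_ge0//; congr Num.sqrt.
by rewrite mulr_sumr; apply: eq_bigr => i _; rewrite mxE exprMn.
Qed.

Lemma dist_set_truncation {R : realType} {d : nat} (A : set 'rV[R]_d)
    (r : R) (x : 'rV[R]_d) (t : R) : 0 < r ->
  dist_set (truncation A r x) (truncation A r x) t -> dist_set A A (r * t).
Proof.
move=> r0 [_ [_ [[y [Ay _] <-] [z [Az _] <-] ->]]]; exists y, z; split=> //.
rewrite -{1}(gtr0_norm r0) -enormZ -scalerBr scalerA mulfV ?gt_eqF// scale1r.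
by rewrite opprB addrA subrK.
Qed.

(** If no n >= N worked, each step would carry a * r n <= t over to n + 1, as
    t must then exceed b * r n >= a * r (n + 1); so r would be bounded. *)
Lemma exists_scale_interval {R : realType} {a b : R} {r : nat -> R} {N : nat}
    {t : R} :
  0 < a -> (forall n, 0 < r n) -> (forall n, r n.+1 / r n <= b / a) ->
  r n @[n --> \oo] --> +oo -> a * r N <= t ->
  exists n, (N <= n)%N /\ a * r n <= t <= b * r n.
Proof.
move=> a0 r0 rS roo aNt; apply: contrapT => noI.
have below k : a * r (N + k)%N <= t.
  elim: k => [|k IH]; first by rewrite addn0.
  rewrite leNgt; apply/negP => tlt; apply: noI; exists (N + k)%N.
  rewrite leq_addr IH; split=> //=; apply: ltW; apply: lt_le_trans tlt _.
  have := rS (N + k)%N; rewrite addnS ler_pdivrMr// mulrAC ler_pdivlMr//.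
  by rewrite mulrC.
move/cvgryPge : roo => /(_ (t / a + 1)) [m _ /(_ (N + m)%N) /=].
rewrite leq_addl => /(_ isT); apply/negP; rewrite -ltNge.
by apply: (@le_lt_trans _ _ (t / a)); rewrite ?ltrDl// ler_pdivlMr// mulrC.
Qed.

Theorem theorem1p5 (R : realType) (d : nat) (rho a b eps : R)
    (hd : (2 <= d)%N) (hrho : 0 < rho < 1)
    (ha : 0 < a) (hab : a < b) (hb : b < 1) (heps : 0 < eps)
    (hP' : propP' d rho a b eps)
    (A : set 'rV[R]_d) (hA : borel A)
    (s : R) (hs : 0 < s <= d%:R) (hseps : d%:R - eps < s)
    (r : nat -> R) (hr1 : forall n, 1 <= r n)
    (hrmono : nondecreasing_seq r) (hroo : r n @[n --> \oo] --> +oo)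
    (hratio : forall n, r n.+1 / r n <= b / a)
    (hcvg : cvgn (fun n =>
       ereal_sup (range (fun x : 'rV[R]_d => hcontent s (truncation A (r n) x)))))
    (hlim : ((1 - rho)%:E < limn (fun n =>
       ereal_sup (range (fun x : 'rV[R]_d =>
         hcontent s (truncation A (r n) x)))))%E) :
  exists M : R, 0 < M /\ `[M, +oo[ `<=` dist_set A A.
Proof.
have r0 n : 0 < r n by exact: lt_le_trans (hr1 n).
have [N _ hN] := hcvg _ (open_nbhs_nbhs (conj (@open_ereal_gt_ereal _ _) hlim)).
exists (a * r N); split=> [|t]; first by rewrite mulr_gt0.
rewrite /= in_itv /= andbT => aNt.
have [n [Nn /andP[ant tbn]]] := exists_scale_interval ha r0 hratio hroo aNt.
have [_ [x _ <-] xlarge] := ereal_sup_gt (hN n Nn).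
set E := truncation A (r n) x.
have bE : borel E by exact: borel_truncation.
have EI : E `<=` @unit_cube R d by exact: truncation_subset_unit_cube.
have E_large : ((1 - rho)%:E <= Order.min (hcontent s E) (hcontent s E))%E.
  by rewrite minxx ltW.
rewrite -(mulfVK (lt0r_neq0 (r0 n)) t) mulrC.
apply: (@dist_set_truncation _ _ _ _ x) => //.
apply: (hP' E E s bE bE EI EI hs (ltW hseps) E_large).
by rewrite /= in_itv /= ler_pdivlMr// ler_pdivrMr// ant.
Qed.
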